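(* Let $r\in\mathbb{N}$, let $(c_k)_{k\in\mathbb{Z}}$ be complex numbers, and let $\beta=(\beta_n)$ be a nonnegative sequence such that $c=(c_n)\in GM(\beta,r)$. Suppose that for some $\gamma>1$ $$\sum_{k=[n/2]}^{n}\beta_k\ll\sum_{k=[n/\gamma]}^{[\gamma n]}|c_k| .$$ If $\|V_n(h)-S_n(h)\|=o(1)$ as $n\to\infty$, then $|c_n|\ln n=o(1)$ as $n\to\infty$.
   Context: $\mathbb{N}=\{1,2,\dots\}$ and $[t]$ is the integer part of $t$. $I_1\ll I_2$ means that there is a constant $K>0$ (independent of $n$) with $I_1\le K I_2$ for all $n\in\mathbb{N}$. Put $\beta_0:=0$ if the index $0$ occurs. For a nonnegative sequence $\beta=(\beta_n)$ and $r\in\mathbb{N}$, a sequence of complex numbers $(a_n)$ belongs to $GM(\beta,r)$ (is $(\beta,r)$-general monotone) if there is a constant $C$ such that $\sum_{n=m}^{2m-1}|a_n-a_{n+r}|\le C\beta_m$ for all $m\in\mathbb{N}$. For the two-sided family $(c_k)_{k\in\mathbb{Z}}$, $(c_n)\in GM(\beta,r)$ refers to this condition for the terms with positive index. The norm is $\|F\|=\frac1{2\pi}\int_{-\pi}^{\pi}|F(x)|\,dx$. The symbol $h$ refers to the trigonometric series $\sum_{k=-\infty}^{\infty}c_ke^{ikx}$, with partial sums $S_n(h,x)=\sum_{k=-n}^{n}c_ke^{ikx}$, and $V_n(h,x)=\frac1{n+1}\sum_{k=0}^{n}S_k(h,x)$. *)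

(* Defs.v *)
(* Stdlib reals with Coquelicot. *)
From Stdlib Require Import Reals ZArith.
From Coquelicot Require Import Coquelicot.
Open Scope R_scope.

(* The condition involves only the terms a_n with n >= 1. *)
Definition GM (beta : nat -> R) (r : nat) (a : nat -> C) : Prop :=
  exists K : R, forall m : nat, (1 <= m)%nat ->
    sum_n_m (fun n => Cmod (a n - a (n + r)%nat)%C) m (2 * m - 1) <= K * beta m.

(* I1 << I2, with n ranging over the positive integers. *)
Definition dominated (I1 I2 : nat -> R) : Prop :=
  exists K : R, 0 < K /\ forall n : nat, (1 <= n)%nat -> I1 n <= K * I2 n.

(* Only applied to nonnegative reals, where Z.to_nat loses nothing. *)
Definition int_part_nat (t : R) : nat := Z.to_nat (Zfloor t).

(* exp (i t) *)
Definition Cexpi (t : R) : C := (cos t, sin t).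

(* The index k of the sum over -n <= k <= n is encoded as j - n, 0 <= j <= 2n. *)
Definition partial_sum (c : Z -> C) (n : nat) (x : R) : C :=
  sum_n_m (fun j : nat =>
      let k := (Z.of_nat j - Z.of_nat n)%Z in (c k * Cexpi (IZR k * x))%C)
    0 (2 * n).

Definition fejer_mean (c : Z -> C) (n : nat) (x : R) : C :=
  (RtoC (/ INR (n + 1)) * sum_n_m (fun k => partial_sum c k x) 0 n)%C.

(* RInt is only used here on continuous integrands (trigonometric polynomials). *)
Definition L1norm (F : R -> C) : R :=
  / (2 * PI) * RInt (fun x => Cmod (F x)) (- PI) PI.

(* Main.v *)
Require Import Defs.
From Stdlib Require Import Reals ZArith Lia Lra.
From Coquelicot Require Import Coquelicot.
Open Scope R_scope.

(** The difference V_n - S_n is the trigonometric polynomial with coefficients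
    - |k| c_k / (n + 1) for |k| <= n ([fejer_mean_minus_partial_sum]). Write e_n for its norm.
    Its last coefficient gives c_n = O(e_n), hence c_n -> 0. To gain a logarithm, integrate it
    against e^(-inx) 2i sum_(j <= N) sin (r j x) / j, which is bounded uniformly in N
    ([sum_sin_over_index_bounded]). Frequencies above n do not occur, so only one side survives:
    | sum_(j <= N) (n - r j) c_(n - r j) / j | <= 6 (n + 1) e_n when r N <= n
    ([one_sided_sum_le_L1norm]).

    The step r in the kernel matches the step of the monotonicity condition. Let
    d_k = |c_k - c_(k+r)|. Replacing c_(n - r j) by c_n costs sums of d over the residue class
    of n, which yields, with H_N = sum_(j <= N) 1/j and 2 r N <= n,
    H_N |c_n| <= 24 e_n + 4 sum_(j <= N) (1/j) sum_(i <= j) d_(n - r i)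
    ([harmonic_mult_coef_le]). Pointwise the last term can be as large as ln N times the
    variation. Summed over n in a window of scale n it is at most N times the variation
    ([sum_harmonic_weighted_variation_le]), without a logarithm.

    The hypotheses on beta bound the sum of d over any window n/Q <= k <= M n by a constant times
    the average of |c_k| over a larger window of the same kind ([variation_le_average]). The
    theorem follows by two passes ([logarithmic_decay]). First, c_n -> 0 makes the variation
    o(1), so the averages of |c_k| are o(1 / ln n). Then the variation itself is o(1 / ln n),
    and so is |c_n|, which differs from an average of |c_k| by at most the variation. *)

(** * Finite sums of real numbers *)

Lemma Rsum_Sm (f : nat -> R) (m n : nat) :
  (m <= S n)%nat -> sum_n_m f m (S n) = sum_n_m f m n + f (S n).
Proof. exact (sum_n_Sm f m n). Qed.

Lemma Rsum_Chasles (f : nat -> R) (m k n : nat) :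
  (m <= S k)%nat -> (k <= n)%nat -> sum_n_m f m n = sum_n_m f m k + sum_n_m f (S k) n.
Proof. exact (sum_n_m_Chasles f m k n). Qed.

Lemma Rsum_empty (f : nat -> R) (m n : nat) : (n < m)%nat -> sum_n_m f m n = 0.
Proof. exact (sum_n_m_zero f m n). Qed.

Lemma Rsum_scal (a : R) (f : nat -> R) (m n : nat) :
  sum_n_m (fun k => a * f k) m n = a * sum_n_m f m n.
Proof. exact (sum_n_m_mult_l (K := R_Ring) a f m n). Qed.

Lemma Rsum_plus (f g : nat -> R) (m n : nat) :
  sum_n_m (fun k => f k + g k) m n = sum_n_m f m n + sum_n_m g m n.
Proof. exact (sum_n_m_plus f g m n). Qed.

Lemma Rsum_ext (f g : nat -> R) (m n : nat) :
  (forall k, (m <= k <= n)%nat -> f k = g k) -> sum_n_m f m n = sum_n_m g m n.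
Proof. exact (sum_n_m_ext_loc f g m n). Qed.

Lemma Rsum_le (f g : nat -> R) (m n : nat) :
  (forall k, (m <= k <= n)%nat -> f k <= g k) -> sum_n_m f m n <= sum_n_m g m n.
Proof.
  intros H. destruct (Nat.le_gt_cases m n) as [Hmn|Hmn].
  2:{ rewrite !Rsum_empty by lia. lra. }
  induction Hmn as [|n Hmn IH].
  - rewrite !sum_n_n. apply H. lia.
  - rewrite !Rsum_Sm by lia. apply Rplus_le_compat; [apply IH; intros|]; apply H; lia.
Qed.

Lemma Rsum_nonneg (f : nat -> R) (m n : nat) :
  (forall k, 0 <= f k) -> 0 <= sum_n_m f m n.
Proof.
  intros H. replace 0 with (sum_n_m (fun _ : nat => 0) m n).
  - now apply sum_n_m_le.
  - rewrite sum_n_m_const. apply Rmult_0_r.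
Qed.

Lemma Rsum_subset (f : nat -> R) (m m' n n' : nat) :
  (forall k, 0 <= f k) -> (m' <= m)%nat -> (n <= n')%nat ->
  sum_n_m f m n <= sum_n_m f m' n'.
Proof.
  intros Hf Hm Hn. destruct (Nat.le_gt_cases m n) as [Hmn|Hmn].
  2:{ rewrite Rsum_empty by lia. now apply Rsum_nonneg. }
  rewrite (Rsum_Chasles f m' n n') by lia.
  pose proof (Rsum_nonneg f (S n) n' Hf).
  destruct m as [|m].
  - replace m' with 0%nat by lia. lra.
  - rewrite (Rsum_Chasles f m' m n) by lia.
    pose proof (Rsum_nonneg f m' m Hf). lra.
Qed.

Lemma Rsum_swap (F : nat -> nat -> R) (p q m n : nat) :
  sum_n_m (fun i => sum_n_m (F i) m n) p q =
  sum_n_m (fun j => sum_n_m (fun i => F i j) p q) m n.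
Proof.
  destruct (Nat.le_gt_cases p q) as [Hpq|Hpq].
  - induction Hpq as [|q Hpq IH].
    + rewrite sum_n_n. apply Rsum_ext. intros k _. now rewrite sum_n_n.
    + rewrite Rsum_Sm, IH, <- Rsum_plus by lia. apply Rsum_ext. intros k _.
      rewrite Rsum_Sm by lia. reflexivity.
  - rewrite Rsum_empty by lia.
    rewrite (Rsum_ext _ (fun _ => 0 * 0)), Rsum_scal by (intros; rewrite Rsum_empty by lia; ring).
    symmetry. apply Rmult_0_l.
Qed.

Lemma Rsum_shift (f : nat -> R) (p q s : nat) :
  sum_n_m (fun n => f (n + s)%nat) p q = sum_n_m f (p + s) (q + s).
Proof.
  revert f. induction s as [|s IH]; intros f.
  - rewrite !Nat.add_0_r. apply Rsum_ext. intros k _. now rewrite Nat.add_0_r.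
  - rewrite !Nat.add_succ_r.
    rewrite <- (sum_n_m_S (G := R_AbelianMonoid)), <- (IH (fun n => f (S n))).
    apply Rsum_ext. intros k _. now rewrite Nat.add_succ_r.
Qed.

Lemma Rsum_shift_back_le (f : nat -> R) (p' p q s : nat) :
  (forall k, 0 <= f k) -> (p' + s <= p)%nat ->
  sum_n_m (fun n => f (n - s)%nat) p q <= sum_n_m f p' q.
Proof.
  intros Hf Hs. destruct (Nat.le_gt_cases p q) as [Hpq|Hpq].
  2:{ rewrite Rsum_empty by lia. now apply Rsum_nonneg. }
  replace p with (p - s + s)%nat by lia. replace q with (q - s + s)%nat at 1 by lia.
  rewrite <- (Rsum_shift (fun n => f (n - s)%nat)).
  rewrite (Rsum_ext _ f) by (intros; f_equal; lia).
  apply Rsum_subset; auto; lia.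
Qed.

(** The points n - r j are distinct, as r >= 1. *)
Lemma Rsum_progression_le (f : nat -> R) (r n N : nat) :
  (forall k, 0 <= f k) -> (1 <= r)%nat -> (r * N <= n)%nat ->
  sum_n_m (fun j => f (n - r * j)%nat) 1 N <= sum_n_m f (n - r * N) n.
Proof.
  intros Hf Hr. induction N as [|N IH]; intros HN.
  - rewrite Rsum_empty by lia. now apply Rsum_nonneg.
  - rewrite Rsum_Sm by lia. specialize (IH ltac:(lia)).
    rewrite (Rsum_Chasles f (n - r * S N) (n - r * S N) n) by lia.
    rewrite sum_n_n.
    pose proof (Rsum_subset f (n - r * N) (S (n - r * S N)) n n Hf ltac:(lia) ltac:(lia)). lra.
Qed.

(** ln (1 + 1/j) <= 1/j. *)
Lemma harmonic_ge_ln (N : nat) : ln (INR (N + 1)) <= sum_n_m (fun j => / INR j) 1 N.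
Proof.
  induction N as [|N IH].
  - rewrite Rsum_empty by lia. simpl. rewrite ln_1. lra.
  - rewrite Rsum_Sm by lia.
    assert (H : 0 < INR (S N)) by (apply lt_0_INR; lia).
    replace (INR (S N + 1)) with (INR (N + 1) * (1 + / INR (S N))).
    2:{ replace (S N + 1)%nat with (S (S N)) by lia. replace (N + 1)%nat with (S N) by lia.
        rewrite (S_INR (S N)). field. lra. }
    pose proof (Rinv_0_lt_compat _ H) as Hi.
    rewrite ln_mult; [|apply lt_0_INR; lia|lra].
    assert (ln (1 + / INR (S N)) <= / INR (S N)).
    { rewrite <- (ln_exp (/ INR (S N))) at 2. apply ln_le; [lra|]. left. apply exp_ineq1. lra. }
    lra.
Qed.

(** n < q (N + 1) for N = n / q, and n >= q^2 makes ln q at most half of ln n. *)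
Lemma ln_le_harmonic (q n : nat) :
  (1 <= q)%nat -> (q * q <= n)%nat ->
  ln (INR n) <= 2 * sum_n_m (fun j => / INR j) 1 (n / q).
Proof.
  intros Hq Hn.
  pose proof (harmonic_ge_ln (n / q)) as HH. set (N := (n / q)%nat) in *.
  assert (HN : (n < q * (N + 1))%nat).
  { rewrite Nat.add_1_r. unfold N. apply Nat.mul_succ_div_gt. lia. }
  assert (Hq0 : 0 < INR q) by (apply lt_0_INR; lia).
  assert (HN0 : 0 < INR (N + 1)) by (apply lt_0_INR; lia).
  assert (H1 : ln (INR n) <= ln (INR q) + ln (INR (N + 1))).
  { rewrite <- ln_mult, <- mult_INR by assumption.
    apply ln_le; [apply lt_0_INR; nia | apply le_INR; lia]. }
  assert (H2 : ln (INR q) + ln (INR q) <= ln (INR n)).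
  { rewrite <- ln_mult, <- mult_INR by assumption.
    apply ln_le; [apply lt_0_INR; nia | apply le_INR; lia]. }
  lra.
Qed.

(** * Uniform boundedness of the sums of sin (j x) / j *)

(** Summation by parts; the weights 1/j decrease, so the total is twice the first weight. *)
Lemma abel_tail_bound (u : nat -> R) (M : nat) :
  (1 <= M)%nat -> (forall j, Rabs (u j) <= 1) ->
  forall N, Rabs (sum_n_m (fun j => / INR j * (u (j - 1)%nat - u j)) M N) <= 2 / INR M.
Proof.
  intros HM Hu.
  assert (HM0 : 0 < INR M) by (apply lt_0_INR; lia).
  assert (Hinv : 0 < / INR M) by now apply Rinv_0_lt_compat.
  (* Keeping the boundary term u_N / N on the left makes the induction on N go through. *)
  assert (Hstrong : forall p, Rabs (sum_n_m (fun j => / INR j * (u (j - 1)%nat - u j)) M (M + p)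
      + u (M + p)%nat / INR (M + p)) <= 2 / INR M - / INR (M + p)).
  { induction p as [|p IH].
    - rewrite Nat.add_0_r, sum_n_n.
      replace (_ + _) with (/ INR M * u (M - 1)%nat) by (field; lra).
      rewrite Rabs_mult, (Rabs_pos_eq (/ INR M)) by lra.
      specialize (Hu (M - 1)%nat). nra.
    - rewrite Nat.add_succ_r, Rsum_Sm by lia.
      replace (S (M + p) - 1)%nat with (M + p)%nat by lia.
      set (q := (M + p)%nat) in *.
      assert (0 < INR q) by (apply lt_0_INR; unfold q; lia).
      assert (INR q < INR (S q)) by (rewrite S_INR; lra).
      assert (/ INR (S q) < / INR q) by (apply Rinv_lt_contravar; nra).
      set (X := sum_n_m _ M q) in *.
      replace (X + / INR (S q) * (u q - u (S q)) + u (S q) / INR (S q))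
        with ((X + u q / INR q) + - (u q * (/ INR q - / INR (S q)))) by (field; lra).
      eapply Rle_trans; [apply Rabs_triang|]. rewrite Rabs_Ropp, Rabs_mult.
      rewrite (Rabs_pos_eq (/ INR q - _)) by lra.
      specialize (Hu q). nra. }
  intros N. destruct (Nat.le_gt_cases M N) as [HN|HN].
  - specialize (Hstrong (N - M)%nat). replace (M + (N - M))%nat with N in Hstrong by lia.
    assert (0 < INR N) by (apply lt_0_INR; lia).
    assert (0 < / INR N) by now apply Rinv_0_lt_compat.
    assert (Hq : Rabs (u N / INR N) <= / INR N).
    { unfold Rdiv. rewrite Rabs_mult, (Rabs_pos_eq (/ INR N)) by lra. specialize (Hu N). nra. }
    apply Rabs_le_between in Hstrong. apply Rabs_le_between in Hq. apply Rabs_le_between. lra.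
  - rewrite Rsum_empty by lia. rewrite Rabs_R0.
    apply Rlt_le, Rdiv_lt_0_compat; lra.
Qed.

(** Induction with the addition formula. At half angles it bounds each term sin (j x) / j
    by 2 |sin (x/2)|, uniformly in j and for all real x at once. *)
Lemma Rabs_sin_mult (x : R) (j : nat) : Rabs (sin (INR j * x)) <= INR j * Rabs (sin x).
Proof.
  induction j as [|j IH].
  - simpl. rewrite !Rmult_0_l, sin_0, Rabs_R0. lra.
  - rewrite S_INR, Rmult_plus_distr_r, Rmult_1_l, sin_plus.
    eapply Rle_trans; [apply Rabs_triang|]. rewrite !Rabs_mult.
    assert (Rabs (cos x) <= 1) by (apply Rabs_le, COS_bound).
    assert (Rabs (cos (INR j * x)) <= 1) by (apply Rabs_le, COS_bound).
    pose proof (Rabs_pos (sin x)). pose proof (Rabs_pos (sin (INR j * x))). nra.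
Qed.

(** With s = |sin (x/2)|: every term is at most 2 s, which settles the indices j <= 1/s;
    beyond 1/s, summation by parts gives at most (2 s)^-1 2 s = 1. *)
Lemma sum_sin_over_index_bounded (N : nat) (x : R) :
  Rabs (sum_n_m (fun j => / INR j * sin (INR j * x)) 1 N) <= 3.
Proof.
  set (s := Rabs (sin (x / 2))).
  assert (Hs : 0 <= s) by apply Rabs_pos.
  assert (Hsmall : forall j, (1 <= j)%nat -> Rabs (/ INR j * sin (INR j * x)) <= 2 * s).
  { intros j Hj. assert (0 < INR j) by (apply lt_0_INR; lia).
    assert (0 < / INR j) by now apply Rinv_0_lt_compat.
    rewrite Rabs_mult, (Rabs_pos_eq (/ INR j)) by lra.
    replace (INR j * x) with (INR (2 * j) * (x / 2)) by (rewrite mult_INR; simpl; field).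
    pose proof (Rabs_sin_mult (x / 2) (2 * j)) as Hj2. fold s in Hj2.
    rewrite mult_INR in Hj2. simpl (INR 2) in Hj2.
    apply Rle_trans with (/ INR j * (2 * INR j * s)).
    - apply Rmult_le_compat_l; [lra | rewrite mult_INR; exact Hj2].
    - apply Req_le. field. lra. }
  assert (Hhead : forall M, INR M * s <= 1 ->
      Rabs (sum_n_m (fun j => / INR j * sin (INR j * x)) 1 M) <= 2).
  { intros M HM. eapply Rle_trans; [apply (norm_sum_n_m (K := R_AbsRing) (V := R_NormedModule))|].
    eapply Rle_trans; [apply (Rsum_le _ (fun _ => 2 * s)); intros k Hk; apply Hsmall; lia|].
    rewrite sum_n_m_const. replace (S M - 1)%nat with M by lia. lra. }
  (* Cut at the last M with M s <= 1. *)
  destruct (Rle_lt_dec (INR N * s) 1) as [HN|HN].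
  { eapply Rle_trans; [now apply Hhead | lra]. }
  assert (Hs0 : 0 < s) by (pose proof (pos_INR N); nra).
  assert (exists M, (M <= N)%nat /\ INR M * s <= 1 /\ 1 < INR (S M) * s) as (M & HMN & HM1 & HM2).
  { clear Hhead. induction N as [|N IH].
    - simpl in HN. lra.
    - destruct (Rle_lt_dec (INR N * s) 1) as [H|H].
      + exists N. repeat split; auto.
      + destruct (IH H) as (M & H1 & H2 & H3). exists M. repeat split; auto. }
  rewrite (Rsum_Chasles _ 1 M N) by lia.
  eapply Rle_trans; [apply Rabs_triang|].
  specialize (Hhead M HM1).
  enough (Rabs (sum_n_m (fun j => / INR j * sin (INR j * x)) (S M) N) <= 1) by lra.
  (* 2 sin (x/2) sin (j x) = u_(j-1) - u_j *)
  pose (u := fun j : nat => cos ((INR j + / 2) * x)).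
  assert (Hu : forall j, Rabs (u j) <= 1) by (intros; apply Rabs_le, COS_bound).
  pose proof (abel_tail_bound u (S M) ltac:(lia) Hu N) as Ht.
  rewrite (Rsum_ext _ (fun j => (2 * sin (x / 2)) * (/ INR j * sin (INR j * x)))) in Ht.
  2:{ intros k Hk. unfold u.
      replace ((INR (k - 1) + / 2) * x) with (INR k * x - x / 2)
        by (rewrite minus_INR by lia; simpl; field).
      replace ((INR k + / 2) * x) with (INR k * x + x / 2) by field.
      rewrite cos_plus, cos_minus. ring. }
  rewrite Rsum_scal in Ht.
  set (Y := sum_n_m _ (S M) N) in *.
  rewrite !Rabs_mult, (Rabs_pos_eq 2) in Ht by lra. fold s in Ht.
  assert (0 < INR (S M)) by (apply lt_0_INR; lia).
  assert (Ht2 : 2 / INR (S M) < 2 * s).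
  { apply Rmult_lt_reg_r with (INR (S M)); auto.
    unfold Rdiv. rewrite Rmult_assoc, Rinv_l by lra. lra. }
  pose proof (Rabs_pos Y). nra.
Qed.

(** * Trigonometric polynomials *)

Lemma Cexpi_plus (s t : R) : Cexpi (s + t) = (Cexpi s * Cexpi t)%C.
Proof. unfold Cexpi, Cmult; simpl. rewrite cos_plus, sin_plus. f_equal; ring. Qed.

Lemma Cmod_Cexpi (t : R) : Cmod (Cexpi t) = 1.
Proof.
  unfold Cmod, Cexpi; simpl fst; simpl snd. rewrite <- sqrt_1. f_equal.
  pose proof (sin2_cos2 t). unfold Rsqr in *. nra.
Qed.

Lemma Csum_Sm (f : nat -> C) (m n : nat) :
  (m <= S n)%nat -> sum_n_m f m (S n) = (sum_n_m f m n + f (S n))%C.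
Proof. exact (sum_n_Sm (G := C_AbelianMonoid) f m n). Qed.

Definition symsum (f : Z -> C) (n : nat) : C :=
  sum_n_m (fun j : nat => f (Z.of_nat j - Z.of_nat n)%Z) 0 (2 * n).

Lemma symsum_0 (f : Z -> C) : symsum f 0 = f 0%Z.
Proof. exact (sum_n_n _ 0%nat). Qed.

(** Sums over -n <= k <= n grow by two outer terms; every induction on trigonometric
    polynomials below uses this step. *)
Lemma symsum_S (f : Z -> C) (n : nat) :
  symsum f (S n) = (symsum f n + (f (Z.of_nat (S n)) + f (- Z.of_nat (S n))%Z))%C.
Proof.
  unfold symsum. replace (2 * S n)%nat with (S (S (2 * n))) by lia.
  rewrite (sum_Sn_m (G := C_AbelianMonoid)) by lia.
  rewrite <- (sum_n_m_S (G := C_AbelianMonoid)).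
  rewrite (sum_n_Sm (G := C_AbelianMonoid)) by lia.
  rewrite (sum_n_m_ext_loc (G := C_AbelianMonoid) _ (fun j : nat => f (Z.of_nat j - Z.of_nat n)%Z)).
  2:{ intros k Hk. f_equal. lia. }
  replace (Z.of_nat 0 - Z.of_nat (S n))%Z with (- Z.of_nat (S n))%Z by lia.
  replace (Z.of_nat (S (S (2 * n))) - Z.of_nat (S n))%Z with (Z.of_nat (S n)) by lia.
  change (@plus C_AbelianMonoid) with Cplus.
  set (X := sum_n_m _ _ _). change (AbelianMonoid.sort C_AbelianMonoid) with C in X.
  ring.
Qed.

Definition trig_poly (t : Z -> C) (n : nat) (x : R) : C :=
  symsum (fun k => t k * Cexpi (IZR k * x))%C n.

Lemma fejer_mean_minus_partial_sum (c : Z -> C) (n : nat) (x : R) :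
  (fejer_mean c n x - partial_sum c n x)%C =
  trig_poly (fun k => RtoC (- IZR (Z.abs k) / INR (n + 1)) * c k)%C n x.
Proof.
  assert (Hn : RtoC (INR (n + 1)) <> 0%C).
  { intros H. apply RtoC_inj in H. revert H. apply not_0_INR. lia. }
  (* Passing from q to q + 1 adds q + 1 times S_q - S_(q+1), that is, minus the outer terms. *)
  assert (Hind : forall q : nat,
    (sum_n_m (fun k => partial_sum c k x) 0 q - RtoC (INR (q + 1)) * partial_sum c q x)%C =
    symsum (fun k => (RtoC (- IZR (Z.abs k)) * c k) * Cexpi (IZR k * x))%C q).
  { induction q as [|q IH].
    - rewrite sum_n_n, symsum_0. unfold plus; simpl.
      change (partial_sum c 0 x) with (symsum (fun k => c k * Cexpi (IZR k * x))%C 0).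
      rewrite symsum_0. simpl. replace (- 0) with 0 by ring. ring.
    - rewrite Csum_Sm by lia. rewrite symsum_S, <- IH.
      change (partial_sum c (S q) x) with (symsum (fun k => c k * Cexpi (IZR k * x))%C (S q)).
      change (partial_sum c q x) with (symsum (fun k => c k * Cexpi (IZR k * x))%C q).
      rewrite symsum_S.
      replace (Z.abs (Z.of_nat (S q))) with (Z.of_nat (S q)) by lia.
      replace (Z.abs (- Z.of_nat (S q))) with (Z.of_nat (S q)) by lia.
      rewrite <- INR_IZR_INZ.
      replace (S q + 1)%nat with (S (S q)) by lia. replace (q + 1)%nat with (S q) by lia.
      rewrite !S_INR, !RtoC_opp, !RtoC_plus. ring. }
  assert (Hscale : forall q, symsum (fun k => (RtoC (- IZR (Z.abs k) / INR (n + 1)) * c k)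
        * Cexpi (IZR k * x))%C q =
      (RtoC (/ INR (n + 1)) *
       symsum (fun k => (RtoC (- IZR (Z.abs k)) * c k) * Cexpi (IZR k * x)) q)%C).
  { induction q as [|q IH].
    - rewrite !symsum_0. unfold Rdiv. rewrite RtoC_mult. ring.
    - rewrite !symsum_S, IH. unfold Rdiv. rewrite !RtoC_mult. ring. }
  unfold trig_poly. rewrite Hscale, <- Hind. unfold fejer_mean.
  rewrite RtoC_inv. 2:{ intros H; apply Hn. now rewrite H. }
  field. exact Hn.
Qed.

(** * Coefficients as integrals, and bounds by the L1 norm *)

Definition is_CInt (F : R -> C) (l : C) : Prop :=
  is_RInt (V := C_R_NormedModule) F (- PI) PI l.

Lemma is_CInt_ext (F G : R -> C) (l : C) :
  (forall x, F x = G x) -> is_CInt F l -> is_CInt G l.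
Proof. intros H. apply is_RInt_ext. intros x _. apply H. Qed.

Lemma is_CInt_plus (F G : R -> C) (l m : C) :
  is_CInt F l -> is_CInt G m -> is_CInt (fun x => F x + G x)%C (l + m)%C.
Proof. exact (is_RInt_plus (V := C_R_NormedModule) F G (- PI) PI l m). Qed.

(** The real vector space structure of C only offers real scalars; complex ones are obtained
    from the two components. *)
Lemma is_CInt_scal (w : C) (F : R -> C) (l : C) :
  is_CInt F l -> is_CInt (fun x => w * F x)%C (w * l)%C.
Proof.
  intros H.
  pose proof (is_RInt_fct_extend_fst F (- PI) PI l H) as H1.
  pose proof (is_RInt_fct_extend_snd F (- PI) PI l H) as H2.
  apply (is_RInt_fct_extend_pair (fun x => w * F x)%C).
  - apply (is_RInt_minus (V := R_NormedModule)); apply (is_RInt_scal (V := R_NormedModule)); assumption.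
  - apply (is_RInt_plus (V := R_NormedModule)); apply (is_RInt_scal (V := R_NormedModule)); assumption.
Qed.

Lemma is_CInt_Cexpi_0 : is_CInt (fun x => Cexpi (0 * x)) (RtoC (2 * PI)).
Proof.
  apply is_CInt_ext with (fun _ => RtoC 1).
  - intros x. unfold Cexpi. now rewrite Rmult_0_l, cos_0, sin_0.
  - replace (RtoC (2 * PI)) with (scal (V := C_R_NormedModule) (PI - - PI) (RtoC 1)).
    + apply (is_RInt_const (V := C_R_NormedModule)).
    + apply injective_projections;
        [change ((PI - - PI) * 1 = 2 * PI) | change ((PI - - PI) * 0 = 0)]; ring.
Qed.

Lemma sin_IZR_PI (k : Z) : sin (IZR k * PI) = 0.
Proof. apply sin_eq_0_1. now exists k. Qed.

Lemma is_CInt_Cexpi (k : Z) : k <> 0%Z -> is_CInt (fun x => Cexpi (IZR k * x)) 0%C.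
Proof.
  intros Hk. assert (Hk' : IZR k <> 0) by now apply not_0_IZR.
  apply (is_RInt_fct_extend_pair (fun x => Cexpi (IZR k * x))); simpl.
  - replace 0 with (minus (sin (IZR k * PI) / IZR k) (sin (IZR k * - PI) / IZR k)).
    + apply (is_RInt_derive (V := R_CompleteNormedModule) (fun x => sin (IZR k * x) / IZR k)).
      * intros x _. auto_derive; [exact I|]. field. exact Hk'.
      * intros x _. apply (ex_derive_continuous (V := R_NormedModule)). auto_derive. exact I.
    + replace (IZR k * - PI) with (- (IZR k * PI)) by ring.
      rewrite sin_neg, sin_IZR_PI. unfold minus, plus, opp; simpl. field. exact Hk'.
  - replace 0 with (minus (- cos (IZR k * PI) / IZR k) (- cos (IZR k * - PI) / IZR k)).
    + apply (is_RInt_derive (V := R_CompleteNormedModule) (fun x => - cos (IZR k * x) / IZR k)).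
      * intros x _. auto_derive; [exact I|]. field. exact Hk'.
      * intros x _. apply (ex_derive_continuous (V := R_NormedModule)). auto_derive. exact I.
    + replace (IZR k * - PI) with (- (IZR k * PI)) by ring.
      rewrite cos_neg. unfold minus, plus, opp; simpl. field. exact Hk'.
Qed.

Lemma is_CInt_trig_poly_Cexpi (t : Z -> C) (n : nat) (m : Z) :
  is_CInt (fun x => trig_poly t n x * Cexpi (IZR m * x))%C
    (if Z_le_dec (Z.abs m) (Z.of_nat n) then RtoC (2 * PI) * t (- m)%Z else 0)%C.
Proof.
  assert (Hterm : forall k, is_CInt (fun x => (t k * Cexpi (IZR k * x)) * Cexpi (IZR m * x))%C
      (if Z.eq_dec k (- m)%Z then RtoC (2 * PI) * t (- m)%Z else 0)%C).
  { intros k. apply is_CInt_ext with (fun x => t k * Cexpi (IZR (k + m) * x))%C.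
    - intros x. rewrite plus_IZR, Rmult_plus_distr_r, Cexpi_plus. ring.
    - destruct (Z.eq_dec k (- m)) as [->|Hk].
      + rewrite Cmult_comm. replace (- m + m)%Z with 0%Z by ring.
        apply is_CInt_scal, is_CInt_Cexpi_0.
      + replace (RtoC 0) with (t k * 0)%C by ring.
        apply is_CInt_scal, is_CInt_Cexpi. lia. }
  induction n as [|n IH].
  - apply is_CInt_ext with (fun x => (t 0%Z * Cexpi (IZR 0 * x)) * Cexpi (IZR m * x))%C.
    { intros x. unfold trig_poly. now rewrite symsum_0. }
    specialize (Hterm 0%Z).
    destruct Z_le_dec as [H|H], Z.eq_dec as [H'|H']; try lia; exact Hterm.
  - set (e := fun k x => ((t k * Cexpi (IZR k * x)) * Cexpi (IZR m * x))%C) in Hterm.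
    apply is_CInt_ext with (fun x => trig_poly t n x * Cexpi (IZR m * x)
        + (e (Z.of_nat (S n)) x + e (- Z.of_nat (S n))%Z x))%C.
    { intros x. unfold trig_poly, e. rewrite symsum_S. ring. }
    replace (if Z_le_dec (Z.abs m) (Z.of_nat (S n)) then _ else _) with
     ((if Z_le_dec (Z.abs m) (Z.of_nat n) then RtoC (2 * PI) * t (- m)%Z else 0)
      + ((if Z.eq_dec (Z.of_nat (S n)) (- m)%Z then RtoC (2 * PI) * t (- m)%Z else 0)
        + (if Z.eq_dec (- Z.of_nat (S n))%Z (- m)%Z then RtoC (2 * PI) * t (- m)%Z else 0)))%C.
    + apply is_CInt_plus; [exact IH|]. apply is_CInt_plus; apply Hterm.
    + destruct Z_le_dec, Z.eq_dec, Z.eq_dec, Z_le_dec; try lia; ring.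
Qed.

Lemma continuous_symsum (proj : C -> R) (e : Z -> R -> C) (n : nat) (x : R) :
  (forall z w : C, proj (z + w)%C = proj z + proj w) ->
  (forall k, continuous (fun y => proj (e k y)) x) ->
  continuous (fun y => proj (symsum (fun k => e k y) n)) x.
Proof.
  intros Hadd He. induction n as [|n IH].
  - apply (continuous_ext (fun y => proj (e 0%Z y))); [|apply He].
    intros y. now rewrite symsum_0.
  - apply (continuous_ext (fun y => proj (symsum (fun k => e k y) n) +
      (proj (e (Z.of_nat (S n)) y) + proj (e (- Z.of_nat (S n))%Z y)))).
    { intros y. now rewrite symsum_S, !Hadd. }
    apply (continuous_plus (V := R_NormedModule)); [exact IH|].
    apply (continuous_plus (V := R_NormedModule)); apply He.
Qed.

Lemma continuous_Cmod_trig_poly (t : Z -> C) (n : nat) (x : R) :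
  continuous (fun x => Cmod (trig_poly t n x)) x.
Proof.
  assert (H : continuous (fun x => fst (trig_poly t n x)) x /\
              continuous (fun x => snd (trig_poly t n x)) x).
  { split; apply continuous_symsum; try reflexivity; intros k; simpl;
      apply (ex_derive_continuous (V := R_NormedModule)); auto_derive; exact I. }
  assert (Hsq : forall f : R -> R, continuous f x -> continuous (fun y => f y ^ 2) x).
  { intros f Hf. apply (continuous_ext (fun y => Rsqr (f y))); [intros y; apply Rsqr_pow2|].
    now apply (continuous_mult (K := R_AbsRing)). }
  destruct H as [H1 H2]. unfold Cmod. apply continuous_sqrt_comp.
  exact (continuous_plus (V := R_NormedModule) _ _ x (Hsq _ H1) (Hsq _ H2)).
Qed.

(** A bounded multiplier turns an integral of T g into a bound by the L1 norm of T. All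
    information on the coefficients comes from choosing g. *)
Lemma L1norm_dual (t : Z -> C) (n : nat) (g : R -> C) (B : R) (l : C) :
  (forall x, Cmod (g x) <= B) -> is_CInt (fun x => trig_poly t n x * g x)%C l ->
  Cmod l <= B * (2 * PI * L1norm (trig_poly t n)).
Proof.
  intros Hg Hl.
  assert (Hex : ex_RInt (fun x => Cmod (trig_poly t n x)) (- PI) PI).
  { apply (ex_RInt_continuous (V := R_CompleteNormedModule)). intros z _.
    apply continuous_Cmod_trig_poly. }
  assert (HCmod : forall z : C, norm (V := C_R_NormedModule) z = Cmod z).
  { intros z. change (sqrt (Rabs (fst z) ^ 2 + Rabs (snd z) ^ 2) = Cmod z).
    now rewrite !pow2_abs. }
  pose proof PI_RGT_0 as HPI.
  assert (Hnormalize : forall I, 2 * PI * (/ (2 * PI) * I) = I) by (intros; field; lra).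
  unfold L1norm. rewrite Hnormalize.
  rewrite <- HCmod.
  apply (norm_RInt_le (V := C_R_NormedModule) (fun x => trig_poly t n x * g x)%C
    (fun x => B * Cmod (trig_poly t n x)) (- PI) PI); [lra| |exact Hl|].
  - intros x _. rewrite HCmod, Cmod_mult. specialize (Hg x).
    pose proof (Cmod_ge_0 (trig_poly t n x)). nra.
  - apply (is_RInt_scal (V := R_NormedModule)), (RInt_correct (V := R_CompleteNormedModule)), Hex.
Qed.

(** The kernel e^(-inx) 2i sum sin (r j x) / j has frequencies -n + r j and -n - r j. The
    latter pick the coefficients of T at n + r j > n, which vanish, so a bounded kernel
    produces a one-sided sum. The step r selects a single residue class modulo r. *)
Lemma is_CInt_sine_kernel (t : Z -> C) (n r N : nat) :
  (1 <= r)%nat -> (r * N <= n)%nat ->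
  is_CInt (fun x => trig_poly t n x * (Cexpi (- INR n * x) *
      (0, 2 * sum_n_m (fun j => / INR j * sin (INR j * (INR r * x))) 1 N)%R))%C
    (RtoC (2 * PI) *
      sum_n_m (fun j => RtoC (/ INR j) * t (Z.of_nat (n - r * j)))%C 1 N)%C.
Proof.
  intros Hr. induction N as [|N IH]; intros HN.
  - rewrite (sum_n_m_zero (G := C_AbelianMonoid)) by lia.
    apply is_CInt_ext with (fun x => 0 * (trig_poly t n x * Cexpi (IZR 0 * x)))%C.
    + intros x. rewrite Rsum_empty by lia. rewrite Rmult_0_r. change (0, 0) with (RtoC 0). ring.
    + change (@zero C_AbelianMonoid) with (RtoC 0).
      pose proof (is_CInt_scal 0 _ _ (is_CInt_trig_poly_Cexpi t n 0)) as H.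
      rewrite Cmult_0_l in H. rewrite Cmult_0_r. exact H.
  - specialize (IH ltac:(lia)).
    set (w := RtoC (/ INR (S N))).
    set (p := (Z.of_nat (r * S N) - Z.of_nat n)%Z).
    set (q := (- Z.of_nat (r * S N) - Z.of_nat n)%Z).
    pose proof (is_CInt_trig_poly_Cexpi t n p) as Hp.
    pose proof (is_CInt_trig_poly_Cexpi t n q) as Hq.
    destruct Z_le_dec as [_|Hp'] in Hp; [|exfalso; unfold p in Hp'; lia].
    destruct Z_le_dec as [Hq'|_] in Hq; [exfalso; unfold q in Hq'; nia|].
    replace (- p)%Z with (Z.of_nat (n - r * S N)) in Hp by (unfold p; lia).
    rewrite Csum_Sm by lia.
    apply (is_CInt_scal w) in Hp. apply (is_CInt_scal (- w)%C) in Hq.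
    pose proof (is_CInt_plus _ _ _ _ IH (is_CInt_plus _ _ _ _ Hp Hq)) as H.
    eapply eq_ind; [eapply is_CInt_ext; [|exact H]|].
    + intros x. cbv beta.
      rewrite Rsum_Sm by lia.
      set (A := sum_n_m _ 1 N).
      assert (Hc : (Cexpi (- INR n * x) * (0, 2 * (/ INR (S N) * sin (INR (S N) * (INR r * x))))%R)%C
         = (w * Cexpi (IZR p * x) - w * Cexpi (IZR q * x))%C).
      { unfold p, q. rewrite !minus_IZR, opp_IZR, <- !INR_IZR_INZ, mult_INR.
        replace ((INR r * INR (S N) - INR n) * x) with (- INR n * x + INR (S N) * (INR r * x)) by ring.
        replace ((- (INR r * INR (S N)) - INR n) * x) with (- INR n * x + - (INR (S N) * (INR r * x))) by ring.
        rewrite !Cexpi_plus. set (y := INR (S N) * (INR r * x)).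
        replace (Cexpi (- y)) with ((cos y, (- sin y)%R) : C) by (unfold Cexpi; now rewrite cos_neg, sin_neg).
        replace (0, 2 * (/ INR (S N) * sin y))%R with (w * (Cexpi y - (cos y, (- sin y)%R)))%C.
        - ring.
        - unfold w, Cexpi. apply injective_projections; simpl; ring. }
      rewrite Rmult_plus_distr_l.
      replace (0, 2 * A + 2 * (/ INR (S N) * sin (INR (S N) * (INR r * x))))
        with ((0, 2 * A)%R + (0, 2 * (/ INR (S N) * sin (INR (S N) * (INR r * x))))%R)%C
        by (apply injective_projections; simpl; ring).
      rewrite !Cmult_plus_distr_l, Hc. ring.
    + fold w. ring.
Qed.

Lemma coef_le_L1norm (t : Z -> C) (n : nat) :
  Cmod (t (Z.of_nat n)) <= L1norm (trig_poly t n).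
Proof.
  pose proof PI_RGT_0 as HPI.
  pose proof (is_CInt_trig_poly_Cexpi t n (- Z.of_nat n)) as H.
  destruct Z_le_dec as [_|H'] in H; [|lia]. rewrite Z.opp_involutive in H.
  apply L1norm_dual with (B := 1) in H.
  2:{ intros x. rewrite Cmod_Cexpi. lra. }
  rewrite Cmod_mult, Cmod_R, Rabs_pos_eq in H by lra. nra.
Qed.

Lemma one_sided_sum_le_L1norm (t : Z -> C) (n r N : nat) :
  (1 <= r)%nat -> (r * N <= n)%nat ->
  Cmod (sum_n_m (fun j => RtoC (/ INR j) * t (Z.of_nat (n - r * j)))%C 1 N)
    <= 6 * L1norm (trig_poly t n).
Proof.
  intros Hr HN. pose proof PI_RGT_0 as HPI.
  pose proof (is_CInt_sine_kernel t n r N Hr HN) as H.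
  apply L1norm_dual with (B := 6) in H.
  2:{ intros x. rewrite Cmod_mult, Cmod_Cexpi, Rmult_1_l.
      assert (Himag : forall A : R, Rabs A <= 3 -> Cmod (0, 2 * A) <= 6).
      { intros A HA. unfold Cmod; simpl fst; simpl snd.
        replace (0 ^ 2 + (2 * A) ^ 2) with (Rsqr (2 * A)) by (unfold Rsqr; ring).
        rewrite sqrt_Rsqr_abs, Rabs_mult, (Rabs_pos_eq 2) by lra. lra. }
      apply Himag, sum_sin_over_index_bounded. }
  rewrite Cmod_mult, Cmod_R, Rabs_pos_eq in H by lra. nra.
Qed.

(** * Consequences for the coefficients of the series *)

Lemma L1norm_fejer_diff (c : Z -> C) (n : nat) :
  L1norm (fun x : R => (fejer_mean c n x - partial_sum c n x)%C) =
  L1norm (trig_poly (fun k => RtoC (- IZR (Z.abs k) / INR (n + 1)) * c k)%C n).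
Proof.
  unfold L1norm. f_equal. apply RInt_ext. intros x _.
  now rewrite fejer_mean_minus_partial_sum.
Qed.

Lemma L1norm_fejer_diff_nonneg (c : Z -> C) (n : nat) :
  0 <= L1norm (fun x : R => (fejer_mean c n x - partial_sum c n x)%C).
Proof.
  rewrite L1norm_fejer_diff. eapply Rle_trans; [apply Cmod_ge_0 | apply coef_le_L1norm].
Qed.

Lemma coef_le_L1norm_fejer_diff (c : Z -> C) (n : nat) :
  (1 <= n)%nat ->
  Cmod (c (Z.of_nat n)) <= 2 * L1norm (fun x : R => (fejer_mean c n x - partial_sum c n x)%C).
Proof.
  intros Hn. rewrite L1norm_fejer_diff.
  eapply Rle_trans; [|apply Rmult_le_compat_l; [lra | apply coef_le_L1norm]]. cbv beta.
  rewrite Cmod_mult, Cmod_R, Z.abs_eq, <- INR_IZR_INZ by lia.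
  unfold Rdiv. rewrite Rabs_mult, Rabs_Ropp, !Rabs_pos_eq.
  2:{ left. apply Rinv_0_lt_compat, lt_0_INR. lia. }
  2:{ apply pos_INR. }
  assert (H : INR (n + 1) <= 2 * INR n).
  { replace 2 with (INR 2) by (simpl; ring). rewrite <- mult_INR. apply le_INR. lia. }
  assert (Hp : 0 < INR (n + 1)) by (apply lt_0_INR; lia).
  pose proof (Cmod_ge_0 (c (Z.of_nat n))).
  assert (1 <= 2 * (INR n * / INR (n + 1))).
  { apply Rmult_le_reg_r with (INR (n + 1)); [exact Hp|].
    replace (2 * (INR n * / INR (n + 1)) * INR (n + 1)) with (2 * INR n) by (field; lra). lra. }
  nra.
Qed.

(** Telescoping along the residue class of n modulo r. *)
Lemma r_step_variation (z : nat -> C) (r n j : nat) :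
  (r * j <= n)%nat ->
  Cmod (z n - z (n - r * j)%nat)%C <=
  sum_n_m (fun i => Cmod (z (n - r * i)%nat - z (n - r * i + r)%nat)%C) 1 j.
Proof.
  induction j as [|j IH]; intros Hj.
  - rewrite Rsum_empty by lia. rewrite Nat.mul_0_r, Nat.sub_0_r.
    replace (z n - z n)%C with (RtoC 0) by ring. rewrite Cmod_0. lra.
  - rewrite Rsum_Sm by lia. specialize (IH ltac:(lia)).
    replace (n - r * S j + r)%nat with (n - r * j)%nat by lia.
    replace (z n - z (n - r * S j)%nat)%C with
      ((z n - z (n - r * j)%nat) + - (z (n - r * S j)%nat - z (n - r * j)%nat))%C by ring.
    eapply Rle_trans; [apply Cmod_triangle|]. rewrite Cmod_opp. lra.
Qed.

(** The one-sided sum of (n - r j) c_(n - r j) / j is at most 6 (n + 1) times the norm. If all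
    c_(n - r j) equalled c_n, it would be of size n |c_n| ln N; differences of step r measure
    the deviation. The restriction 2 r N <= n keeps n - r j comparable to n. *)
Lemma harmonic_mult_coef_le (c : Z -> C) (r n N : nat) :
  (1 <= r)%nat -> (1 <= n)%nat -> (2 * (r * N) <= n)%nat ->
  sum_n_m (fun j => / INR j) 1 N * Cmod (c (Z.of_nat n)) <=
  4 * (6 * L1norm (fun x : R => (fejer_mean c n x - partial_sum c n x)%C) +
    sum_n_m (fun j => / INR j * sum_n_m (fun i =>
      Cmod (c (Z.of_nat (n - r * i)) - c (Z.of_nat (n - r * i + r)))%C) 1 j) 1 N).
Proof.
  intros Hr Hn HN.
  pose (t := fun k => (RtoC (- IZR (Z.abs k) / INR (n + 1)) * c k)%C).
  rewrite L1norm_fejer_diff. fold t.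
  pose proof (one_sided_sum_le_L1norm t n r N Hr ltac:(lia)) as Hsum.
  assert (Hn1 : 0 < INR (n + 1)) by (apply lt_0_INR; lia).
  pose (w := fun j => INR (n - r * j) / INR (n + 1)).
  (* The factor |k| / (n + 1) at k = n - r j; the bound r j <= n / 2 keeps it above 1/4. *)
  assert (Hw : forall j, (1 <= j <= N)%nat -> / 4 <= w j <= 1).
  { intros j Hj. unfold w.
    assert (HrjN : (r * j <= r * N)%nat) by (apply Nat.mul_le_mono_l; lia).
    assert (H1 : INR (n + 1) <= INR (4 * (n - r * j))) by (apply le_INR; lia).
    assert (H2 : INR (n - r * j) <= INR (n + 1)) by (apply le_INR; lia).
    rewrite mult_INR in H1. replace (INR 4) with 4 in H1 by (simpl; ring).
    pose proof (Rinv_0_lt_compat _ Hn1) as Hi.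
    assert (He : INR (n + 1) * / INR (n + 1) = 1) by (apply Rinv_r; lra).
    unfold Rdiv. split; nra. }
  set (V := fun j : nat => sum_n_m (fun i =>
    Cmod (c (Z.of_nat (n - r * i)) - c (Z.of_nat (n - r * i + r)))%C) 1 j : R).
  (* On replacing every c (n - r j) by c n, the error is the weighted variation. *)
  assert (Hclose : forall P, (P <= N)%nat ->
    Cmod (sum_n_m (fun j => RtoC (/ INR j) * t (Z.of_nat (n - r * j)))%C 1 P
          + RtoC (sum_n_m (fun j => / INR j * w j)%R 1 P) * c (Z.of_nat n))%C
    <= sum_n_m (fun j => / INR j * V j) 1 P).
  { induction P as [|P IH]; intros HP.
    - rewrite (sum_n_m_zero (G := C_AbelianMonoid)) by lia. rewrite !Rsum_empty by lia.
      change (@zero C_AbelianMonoid) with (RtoC 0).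
      replace (_ + _)%C with (RtoC 0) by ring. rewrite Cmod_0. lra.
    - specialize (IH ltac:(lia)). rewrite Csum_Sm, !Rsum_Sm by lia.
      assert (HrP : (r * S P <= r * N)%nat) by (apply Nat.mul_le_mono_l; lia).
      set (X := sum_n_m (fun j => RtoC (/ INR j) * t (Z.of_nat (n - r * j)))%C 1 P) in *.
      change (AbelianMonoid.sort C_AbelianMonoid) with C in X.
      set (Y := sum_n_m (fun j => / INR j * w j) 1 P) in *.
      replace (X + RtoC (/ INR (S P)) * t (Z.of_nat (n - r * S P)) +
          RtoC (Y + / INR (S P) * w (S P)) * c (Z.of_nat n))%C
        with ((X + RtoC Y * c (Z.of_nat n)) +
          RtoC (/ INR (S P) * w (S P)) * (c (Z.of_nat n) - c (Z.of_nat (n - r * S P))))%C.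
      2:{ unfold t. rewrite Z.abs_eq, <- INR_IZR_INZ by lia.
          replace (- INR (n - r * S P) / INR (n + 1)) with (- w (S P)) by (unfold w; field; lra).
          rewrite RtoC_plus, RtoC_mult, RtoC_opp. ring. }
      eapply Rle_trans; [apply Cmod_triangle|].
      apply Rplus_le_compat; [exact IH|].
      pose proof (r_step_variation (fun k => c (Z.of_nat k)) r n (S P) ltac:(lia)) as Hv.
      cbv beta in Hv. fold (V (S P)) in Hv.
      specialize (Hw (S P) ltac:(lia)).
      assert (0 < / INR (S P)) by (apply Rinv_0_lt_compat, lt_0_INR; lia).
      rewrite Cmod_mult, Cmod_R, Rabs_mult, !Rabs_pos_eq by lra.
      rewrite Rmult_assoc. apply Rmult_le_compat_l; [lra|].
      pose proof (Cmod_ge_0 (c (Z.of_nat n) - c (Z.of_nat (n - r * S P)))). nra. }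
  specialize (Hclose N ltac:(lia)).
  set (X := sum_n_m (fun j => RtoC (/ INR j) * t (Z.of_nat (n - r * j)))%C 1 N) in *.
  change (AbelianMonoid.sort C_AbelianMonoid) with C in X.
  set (Y := sum_n_m (fun j => / INR j * w j) 1 N) in *.
  assert (HY : / 4 * sum_n_m (fun j => / INR j) 1 N <= Y).
  { unfold Y. rewrite <- Rsum_scal. apply Rsum_le. intros k Hk.
    specialize (Hw k Hk).
    assert (0 < / INR k) by (apply Rinv_0_lt_compat, lt_0_INR; lia). nra. }
  assert (HH : 0 <= sum_n_m (fun j => / INR j) 1 N).
  { apply Rle_trans with (sum_n_m (fun _ : nat => 0) 1 N).
    - apply Rsum_nonneg. intros _. lra.
    - apply Rsum_le. intros k Hk. left. apply Rinv_0_lt_compat, lt_0_INR. lia. }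
  assert (Htri : Y * Cmod (c (Z.of_nat n)) <= Cmod (X + RtoC Y * c (Z.of_nat n))%C + Cmod X).
  { rewrite <- (Rabs_pos_eq Y) at 1 by lra. rewrite <- Cmod_R, <- Cmod_mult.
    replace (RtoC Y * c (Z.of_nat n))%C with ((X + RtoC Y * c (Z.of_nat n)) + - X)%C at 1 by ring.
    eapply Rle_trans; [apply Cmod_triangle|]. rewrite Cmod_opp. lra. }
  pose proof (Cmod_ge_0 (c (Z.of_nat n))). nra.
Qed.

(** Averaging over n pays off: a single n may carry its variation close to n, with weight about
    ln N, but for each fixed i the sum of f (n - r i) over n is at most the full sum of f. As
    sum_(j <= N) (1/j) j = N, the total carries no logarithm. *)
Lemma sum_harmonic_weighted_variation_le (f : nat -> R) (r N p' p q : nat) :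
  (forall k, 0 <= f k) -> (p' + r * N <= p)%nat ->
  sum_n_m (fun n => sum_n_m (fun j => / INR j * sum_n_m (fun i => f (n - r * i)%nat) 1 j) 1 N) p q
  <= INR N * sum_n_m f p' q.
Proof.
  intros Hf HN. rewrite Rsum_swap.
  apply Rle_trans with (sum_n_m (fun _ : nat => sum_n_m f p' q) 1 N).
  2:{ rewrite sum_n_m_const. replace (S N - 1)%nat with N by lia. lra. }
  apply Rsum_le. intros j Hj. rewrite Rsum_scal, Rsum_swap.
  assert (Hj0 : 0 < INR j) by (apply lt_0_INR; lia).
  apply Rle_trans with (/ INR j * sum_n_m (fun _ : nat => sum_n_m f p' q) 1 j).
  - apply Rmult_le_compat_l; [left; now apply Rinv_0_lt_compat|].
    apply Rsum_le. intros i Hi. apply (Rsum_shift_back_le f p' p q (r * i) Hf). nia.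
  - rewrite sum_n_m_const. replace (S j - 1)%nat with j by lia.
    apply Req_le. rewrite <- Rmult_assoc, Rinv_l by lra. ring.
Qed.

(** * Variation bounded by averages *)

(** The indices from n/Q to M n, with integer constants in place of the real gamma, so that
    all windows of scale n can be compared by inclusion. *)
Definition window_sum (f : nat -> R) (Q M n : nat) : R := sum_n_m f (n / Q) (M * n).

Lemma le_int_part_nat (t : R) (k : nat) : 0 <= t -> INR k <= t -> (k <= int_part_nat t)%nat.
Proof.
  intros Ht Hk. unfold int_part_nat.
  destruct (Zfloor_bound t) as [_ H2]. apply Nat2Z.inj_le.
  assert (Hz : (Z.of_nat k < Zfloor t + 1)%Z).
  { apply lt_IZR. rewrite <- INR_IZR_INZ, plus_IZR. simpl. lra. }
  rewrite Z2Nat.id; lia.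
Qed.

Lemma int_part_nat_le (t : R) (k : nat) : t <= INR k -> (int_part_nat t <= k)%nat.
Proof.
  intros Hk. unfold int_part_nat.
  destruct (Zfloor_bound t) as [H1 _].
  assert (Hz : (Zfloor t <= Z.of_nat k)%Z).
  { apply le_IZR. rewrite <- INR_IZR_INZ. lra. }
  lia.
Qed.

(** The windows [4 t i, 6 t i) leave no gap from i = 2 on, because 4 (i + 1) <= 6 i; their common
    unit t makes the bounds on the individual windows comparable. *)
Lemma cover_by_arithmetic_windows (f : nat -> R) (t : nat) (X : R) (L : nat) :
  (forall k, 0 <= f k) -> (1 <= t)%nat -> 0 <= X ->
  (forall i, (2 <= i <= L)%nat -> sum_n_m f (4 * (t * i)) (6 * (t * i) - 1) <= X) ->
  sum_n_m f (8 * t) (6 * (t * L) - 1) <= INR L * X.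
Proof.
  intros Hf Ht HX. induction L as [|L IH]; intros HL.
  - rewrite Rsum_empty by lia. simpl. lra.
  - rewrite S_INR. specialize (IH ltac:(intros; apply HL; lia)).
    destruct (Nat.le_gt_cases (S L) 1) as [Hsmall|Hbig].
    { rewrite Rsum_empty by nia. pose proof (pos_INR L). nra. }
    specialize (HL (S L) ltac:(lia)).
    destruct (Nat.eq_dec L 1) as [->|HL1].
    { replace (8 * t)%nat with (4 * (t * 2))%nat by lia. simpl (INR 1). lra. }
    rewrite (Rsum_Chasles f (8 * t) (6 * (t * L) - 1) (6 * (t * S L) - 1)) by nia.
    pose proof (Rsum_subset f (S (6 * (t * L) - 1)) (4 * (t * S L)) (6 * (t * S L) - 1)
      (6 * (t * S L) - 1) Hf ltac:(nia) ltac:(lia)). lra.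
Qed.

(** The hypothesis controls only the averages of beta, but each window is contained in a
    positive proportion of the blocks [m, 2m), so an average of beta is enough. Any window
    of scale n is then covered by boundedly many such windows. *)
Lemma variation_le_average (d a beta : nat -> R) (K K2 gamma : R) :
  (forall k, 0 <= d k) -> (forall k, 0 <= a k) -> (forall k, 0 <= beta k) ->
  (forall m, (1 <= m)%nat -> sum_n_m d m (2 * m - 1) <= K * beta m) ->
  1 < gamma -> 0 < K2 ->
  (forall n, (1 <= n)%nat -> sum_n_m beta (n / 2) n <=
     K2 * sum_n_m a (int_part_nat (INR n / gamma)) (int_part_nat (gamma * INR n))) ->
  forall Q M, (1 <= Q)%nat -> (1 <= M)%nat ->
  exists (C : R) (Q' M' : nat), 0 <= C /\ (1 <= Q')%nat /\ (1 <= M')%nat /\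
  forall n, (Q' <= n)%nat ->
    INR n * window_sum d Q M n <= C * window_sum a Q' M' n.
Proof.
  intros Hd Ha Hb HGM Hgam HK2 Hdom Q M HQ HM.
  destruct (nfloor_ex gamma ltac:(lra)) as [g [_ Hg]].
  set (G := (g + 1)%nat).
  assert (HG : gamma <= INR G) by (unfold G; rewrite plus_INR; simpl; lra).
  assert (HG1 : (1 <= G)%nat) by (unfold G; lia).
  clearbody G. clear g Hg.
  (* 18 G Q M u >= 16 G Q M u > M n for u = n / (8 G Q), hence L windows suffice. *)
  set (L := (3 * Q * M)%nat). set (K' := Rabs K).
  assert (HK' : 0 <= K') by apply Rabs_pos.
  exists (16 * INR (G * Q) * INR L * (K' * K2)), (8 * G * Q)%nat, (4 * G * G * L)%nat.
  pose proof (pos_INR (G * Q)) as HGQ. pose proof (pos_INR L) as HLp.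
  split; [repeat apply Rmult_le_pos; lra|]. split; [nia|]. split; [unfold L; nia|].
  intros n Hn.
  set (u := (n / (8 * G * Q))%nat).
  assert (Hu1 : (1 <= u)%nat) by (unfold u; apply Nat.div_le_lower_bound; nia).
  assert (Hu2 : (8 * G * Q * u <= n)%nat) by (unfold u; apply Nat.Div0.mul_div_le).
  assert (Hu3 : (n < 8 * G * Q * S u)%nat) by (unfold u; apply Nat.mul_succ_div_gt; nia).
  set (t := (G * u)%nat).
  assert (Ht1 : (1 <= t)%nat) by (unfold t; nia).
  set (A := window_sum a (8 * G * Q) (4 * G * G * L) n).
  assert (HA : 0 <= A) by (apply Rsum_nonneg; exact Ha).
  (* The window [4s, 6s) lies in every block [m, 2m) with 3s <= m <= 4s, so the mean of
     beta over these m bounds the variation there. *)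
  assert (Hblock : forall i, (2 <= i <= L)%nat ->
      sum_n_m d (4 * (t * i)) (6 * (t * i) - 1) <= / INR t * (K' * K2 * A)).
  { intros i Hi. set (s := (t * i)%nat).
    assert (Hs : (1 <= s)%nat) by (unfold s; nia).
    set (D := sum_n_m d (4 * s) (6 * s - 1)).
    assert (HD : 0 <= D) by (apply Rsum_nonneg; exact Hd).
    assert (H1 : forall m, (3 * s <= m <= 4 * s)%nat -> D <= K' * beta m).
    { intros m Hm. apply Rle_trans with (sum_n_m d m (2 * m - 1)).
      - apply Rsum_subset; auto; lia.
      - eapply Rle_trans; [apply HGM; lia|].
        apply Rmult_le_compat_r; [apply Hb | apply Rle_abs]. }
    assert (H2 : INR s * D <= K' * sum_n_m beta (3 * s) (4 * s)).
    { rewrite <- Rsum_scal.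
      apply Rle_trans with (sum_n_m (fun _ : nat => D) (3 * s) (4 * s)).
      - rewrite sum_n_m_const. apply Rmult_le_compat_r; [exact HD|]. apply le_INR. lia.
      - apply Rsum_le. exact H1. }
    assert (H3 : sum_n_m beta (3 * s) (4 * s) <= K2 * A).
    { apply Rle_trans with (sum_n_m beta ((4 * s) / 2) (4 * s)).
      - apply Rsum_subset; auto. apply Nat.Div0.div_le_upper_bound. lia.
      - eapply Rle_trans; [apply Hdom; lia|].
        apply Rmult_le_compat_l; [lra|]. unfold A, window_sum.
        assert (Hpos : 0 < INR (4 * s)) by (apply lt_0_INR; lia).
        apply Rsum_subset; auto.
        + fold u. apply le_int_part_nat.
          * apply Rlt_le, Rdiv_lt_0_compat; lra.
          * apply Rmult_le_reg_r with gamma; [lra|].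
            unfold Rdiv. rewrite Rmult_assoc, Rinv_l, Rmult_1_r by lra.
            apply Rle_trans with (INR u * INR G).
            { apply Rmult_le_compat_l; [apply pos_INR | exact HG]. }
            rewrite <- mult_INR. apply le_INR. unfold s, t. nia.
        + apply int_part_nat_le.
          apply Rle_trans with (INR G * INR (4 * s)).
          { apply Rmult_le_compat_r; lra. }
          rewrite <- mult_INR. apply le_INR. unfold s, t.
          assert (G * u <= n)%nat by nia.
          assert (G * u * i <= n * L)%nat by (apply Nat.mul_le_mono; lia). nia. }
    assert (Hts : INR t <= INR s) by (apply le_INR; unfold s; nia).
    assert (Ht0 : 0 < INR t) by (apply lt_0_INR; lia).
    apply Rmult_le_reg_l with (INR t); [exact Ht0|].
    rewrite <- Rmult_assoc, Rinv_r, Rmult_1_l by lra.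
    apply Rle_trans with (INR s * D); [apply Rmult_le_compat_r; lra|].
    eapply Rle_trans; [exact H2|]. rewrite Rmult_assoc.
    apply Rmult_le_compat_l; lra. }
  assert (Ht0 : 0 < INR t) by (apply lt_0_INR; lia).
  assert (HX : 0 <= / INR t * (K' * K2 * A)).
  { apply Rmult_le_pos; [left; now apply Rinv_0_lt_compat|]. repeat apply Rmult_le_pos; lra. }
  pose proof (cover_by_arithmetic_windows d t _ L Hd Ht1 HX Hblock) as Hcover.
  assert (HW : window_sum d Q M n <= sum_n_m d (8 * t) (6 * (t * L) - 1)).
  { unfold window_sum. apply Rsum_subset; auto.
    - apply Nat.div_le_lower_bound; unfold t; nia.
    - assert (M * n + 1 <= 6 * (t * L))%nat; [|lia].
      assert (n < 16 * G * Q * u)%nat by nia.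
      unfold t, L. replace (6 * (G * u * (3 * Q * M)))%nat with (M * (18 * G * Q * u))%nat by ring. nia. }
  assert (HW0 : 0 <= window_sum d Q M n) by (apply Rsum_nonneg; exact Hd).
  assert (Hnt : INR n <= 16 * INR Q * INR t).
  { replace 16 with (INR 16) by (simpl; ring). rewrite <- !mult_INR. apply le_INR. unfold t. nia. }
  assert (HQ0 : 0 < INR Q) by (apply lt_0_INR; lia).
  assert (HQG : INR Q <= INR (G * Q)) by (apply le_INR; nia).
  assert (HF : INR t * window_sum d Q M n <= INR L * (K' * K2) * A).
  { apply Rle_trans with (INR t * (INR L * (/ INR t * (K' * K2 * A)))).
    - apply Rmult_le_compat_l; lra.
    - apply Req_le. field. lra. }
  assert (HB : 0 <= INR L * (K' * K2) * A) by (repeat apply Rmult_le_pos; lra).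
  apply Rle_trans with (16 * INR Q * (INR t * window_sum d Q M n)).
  { rewrite <- Rmult_assoc. apply Rmult_le_compat_r; lra. }
  apply Rle_trans with (16 * INR (G * Q) * (INR L * (K' * K2) * A)); [|lra].
  apply Rle_trans with (16 * INR Q * (INR L * (K' * K2) * A)).
  - apply Rmult_le_compat_l; lra.
  - apply Rmult_le_compat_r; lra.
Qed.

(** * Decay with a logarithm *)

Lemma squeeze_0 (u v : nat -> R) (n0 : nat) :
  (forall n, (n0 <= n)%nat -> 0 <= u n <= v n) -> is_lim_seq v 0 -> is_lim_seq u 0.
Proof.
  intros H Hv. apply (is_lim_seq_le_le_loc (fun _ => 0) u v 0).
  - now exists n0.
  - apply is_lim_seq_const.
  - exact Hv.
Qed.

Lemma scal_lim_0 (K : R) (u : nat -> R) :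
  is_lim_seq u 0 -> is_lim_seq (fun n => K * u n) 0.
Proof.
  intros H. pose proof (is_lim_seq_scal_l u K 0 H) as H'. simpl in H'.
  now rewrite Rmult_0_r in H'.
Qed.

Lemma plus_lim_0 (u v : nat -> R) :
  is_lim_seq u 0 -> is_lim_seq v 0 -> is_lim_seq (fun n => u n + v n) 0.
Proof.
  intros Hu Hv. pose proof (is_lim_seq_plus' u v 0 0 Hu Hv) as H.
  now rewrite Rplus_0_r in H.
Qed.

Lemma window_average_lim_0 (f : nat -> R) (Q M : nat) :
  (forall k, 0 <= f k) -> (1 <= Q)%nat -> (1 <= M)%nat -> is_lim_seq f 0 ->
  is_lim_seq (fun n => window_sum f Q M n / INR n) 0.
Proof.
  intros Hf HQ HM Hlim. apply is_lim_seq_spec. intros eps.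
  assert (HMpos : 0 < INR M) by (apply lt_0_INR; lia).
  assert (Heps : 0 < eps / (4 * INR M)).
  { pose proof (cond_pos eps). apply Rdiv_lt_0_compat; lra. }
  apply is_lim_seq_spec in Hlim. destruct (Hlim (mkposreal _ Heps)) as [k0 Hk0].
  simpl in Hk0. exists (S (Q * S k0)). intros n Hn.
  assert (Hnpos : 0 < INR n) by (apply lt_0_INR; nia).
  rewrite Rminus_0_r, Rabs_pos_eq.
  2:{ apply Rle_mult_inv_pos; [now apply Rsum_nonneg | exact Hnpos]. }
  assert (HW : window_sum f Q M n <= INR (2 * M * n) * (eps / (4 * INR M))).
  { apply Rle_trans with (sum_n_m (fun _ : nat => eps / (4 * INR M)) (n / Q) (M * n)).
    - apply Rsum_le. intros k Hk.
      assert (S k0 <= n / Q)%nat by (apply Nat.div_le_lower_bound; nia).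
      specialize (Hk0 k ltac:(lia)). rewrite Rminus_0_r, Rabs_pos_eq in Hk0 by auto. lra.
    - rewrite sum_n_m_const. apply Rmult_le_compat_r; [lra|]. apply le_INR. nia. }
  rewrite !mult_INR in HW. replace (INR 2) with 2 in HW by (simpl; ring).
  apply Rmult_lt_reg_r with (INR n); [exact Hnpos|].
  unfold Rdiv at 1. rewrite Rmult_assoc, Rinv_l, Rmult_1_r by lra.
  eapply Rle_lt_trans; [exact HW|].
  replace (2 * INR M * INR n * (eps / (4 * INR M))) with (eps / 2 * INR n) by (field; lra).
  pose proof (cond_pos eps). nra.
Qed.

(** The variation of step r is used twice. As a tends to 0, so do its averages and with them
    the variation on windows; the averaged logarithmic inequality then makes the averages of a
    o(1 / ln n). Consequently the variation is o(1 / ln n) as well, and a n differs from an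
    average of a by at most the variation. *)
Lemma logarithmic_decay (a d e : nat -> R) (r : nat) :
  (1 <= r)%nat ->
  (forall k, 0 <= a k) -> (forall k, 0 <= d k) -> (forall k, 0 <= e k) ->
  is_lim_seq e 0 ->
  (forall n, (1 <= n)%nat -> a n <= 2 * e n) ->
  (forall n N, (1 <= n)%nat -> (2 * (r * N) <= n)%nat ->
     sum_n_m (fun j => / INR j) 1 N * a n <=
     4 * (6 * e n + sum_n_m (fun j => / INR j * sum_n_m (fun i => d (n - r * i)%nat) 1 j) 1 N)) ->
  (forall n j, (r * j <= n)%nat ->
     a n <= a (n - r * j)%nat + sum_n_m (fun i => d (n - r * i)%nat) 1 j) ->
  (forall Q M, (1 <= Q)%nat -> (1 <= M)%nat ->
     exists (C : R) (Q' M' : nat), 0 <= C /\ (1 <= Q')%nat /\ (1 <= M')%nat /\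
     forall n, (Q' <= n)%nat ->
       INR n * window_sum d Q M n <= C * window_sum a Q' M' n) ->
  is_lim_seq (fun n => a n * ln (INR n)) 0.
Proof.
  intros Hr Ha Hd He Hlim_e Hae Hlog Htel Hvar.
  assert (Hln : forall n, (1 <= n)%nat -> 0 <= ln (INR n)).
  { intros n Hn. rewrite <- ln_1. apply ln_le; [lra|]. apply (le_INR 1). exact Hn. }
  assert (HW0 : forall f Q M n, (forall k, 0 <= f k) -> 0 <= window_sum f Q M n).
  { intros. now apply Rsum_nonneg. }
  assert (Hlim_a : is_lim_seq a 0).
  { apply squeeze_0 with (fun n => 2 * e n) 1%nat.
    - intros n Hn. split; auto.
    - now apply scal_lim_0. }
  assert (Hlim_d : forall Q M, (1 <= Q)%nat -> (1 <= M)%nat ->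
      is_lim_seq (fun n => window_sum d Q M n) 0).
  { intros Q M HQ HM. destruct (Hvar Q M HQ HM) as (C & Q' & M' & HC & HQ' & HM' & H).
    apply squeeze_0 with (fun n => C * (window_sum a Q' M' n / INR n)) Q'.
    - intros n Hn. split; [now apply HW0|].
      assert (0 < INR n) by (apply lt_0_INR; lia).
      apply Rmult_le_reg_l with (INR n); [assumption|].
      replace (INR n * (C * (window_sum a Q' M' n / INR n))) with (C * window_sum a Q' M' n)
        by (field; lra). auto.
    - apply scal_lim_0, window_average_lim_0; auto. }
  (* The pointwise inequality summed over the window: the divergent harmonic factor
     is paid by the window average of e and by the variation alone. *)
  assert (Hlim_aln : forall Q M, (1 <= Q)%nat -> (1 <= M)%nat ->
      is_lim_seq (fun n => ln (INR n) * (window_sum a Q M n / INR n)) 0).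
  { intros Q M HQ HM. set (q := (2 * r * Q)%nat).
    apply squeeze_0 with (fun n => 48 * (window_sum e Q M n / INR n)
        + 8 * window_sum d (2 * Q) M n) (q * q)%nat.
    2:{ apply plus_lim_0; apply scal_lim_0; [apply window_average_lim_0; auto|].
        apply Hlim_d; lia. }
    intros n Hn. assert (Hn1 : (1 <= n)%nat) by (unfold q in Hn; nia).
    assert (Hnpos : 0 < INR n) by (apply lt_0_INR; lia).
    pose proof (HW0 a Q M n Ha) as Hwa. pose proof (HW0 d (2 * Q)%nat M n Hd) as Hwd.
    split; [apply Rmult_le_pos; [now apply Hln | now apply Rle_mult_inv_pos]|].
    pose proof (ln_le_harmonic q n ltac:(unfold q; nia) Hn) as HH.
    set (N := (n / q)%nat) in *.
    assert (HN : (2 * (r * N) <= n / Q)%nat).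
    { unfold N, q. rewrite (Nat.mul_comm (2 * r) Q), <- Nat.Div0.div_div.
      rewrite Nat.mul_assoc. apply Nat.Div0.mul_div_le. }
    assert (HNn : INR N <= INR n) by (apply le_INR, Nat.Div0.div_le_upper_bound; unfold q; nia).
    set (H := sum_n_m (fun j => / INR j) 1 N) in *.
    assert (Hmain : H * window_sum a Q M n <= 24 * window_sum e Q M n
         + 4 * (INR N * window_sum d (2 * Q) M n)).
    { unfold window_sum at 1. rewrite <- Rsum_scal.
      apply Rle_trans with (sum_n_m (fun k => 24 * e k + 4 *
        sum_n_m (fun j => / INR j * sum_n_m (fun i => d (k - r * i)%nat) 1 j) 1 N) (n / Q) (M * n)).
      - apply Rsum_le. intros k Hk.
        assert (Hq1 : (1 <= n / Q)%nat).
        { apply Nat.div_le_lower_bound; unfold q in Hn; nia. }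
        specialize (Hlog k N ltac:(lia) ltac:(lia)). fold H in Hlog. lra.
      - rewrite Rsum_plus, !Rsum_scal. apply Rplus_le_compat_l, Rmult_le_compat_l; [lra|].
        apply sum_harmonic_weighted_variation_le; [exact Hd|].
        rewrite (Nat.mul_comm 2 Q), <- Nat.Div0.div_div.
        pose proof (Nat.Div0.mul_div_le (n / Q) 2). nia. }
    apply Rmult_le_reg_r with (INR n); [exact Hnpos|].
    replace (ln (INR n) * (window_sum a Q M n / INR n) * INR n)
      with (ln (INR n) * window_sum a Q M n) by (field; lra).
    replace ((48 * (window_sum e Q M n / INR n) + 8 * window_sum d (2 * Q) M n) * INR n)
      with (48 * window_sum e Q M n + 8 * (INR n * window_sum d (2 * Q) M n)) by (field; lra).
    nra. }
  (* A second use of the variation bound, now with the decay of the averages of a. *)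
  assert (Hlim_dln : is_lim_seq (fun n => ln (INR n) * window_sum d 2 1 n) 0).
  { destruct (Hvar 2%nat 1%nat ltac:(lia) ltac:(lia)) as (C & Q' & M' & HC & HQ' & HM' & H).
    apply squeeze_0 with (fun n => C * (ln (INR n) * (window_sum a Q' M' n / INR n))) Q'.
    2:{ now apply scal_lim_0, Hlim_aln. }
    intros n Hn. pose proof (Hln n ltac:(lia)) as Hl. pose proof (HW0 d 2%nat 1%nat n Hd).
    split; [now apply Rmult_le_pos|].
    assert (Hnpos : 0 < INR n) by (apply lt_0_INR; lia).
    replace (C * (ln (INR n) * (window_sum a Q' M' n / INR n)))
      with (ln (INR n) * (C * window_sum a Q' M' n / INR n)) by (field; lra).
    apply Rmult_le_compat_l; [exact Hl|].
    apply Rmult_le_reg_l with (INR n); [exact Hnpos|].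
    replace (INR n * (C * window_sum a Q' M' n / INR n)) with (C * window_sum a Q' M' n)
      by (field; lra). auto. }
  apply squeeze_0 with (fun n => 4 * INR r * (ln (INR n) * (window_sum a 2 1 n / INR n))
      + ln (INR n) * window_sum d 2 1 n) (2 * r)%nat.
  2:{ apply plus_lim_0; [apply scal_lim_0, Hlim_aln; lia | exact Hlim_dln]. }
  intros n Hn. pose proof (Hln n ltac:(lia)) as Hl.
  split; [now apply Rmult_le_pos|].
  assert (Hnpos : 0 < INR n) by (apply lt_0_INR; lia).
  enough (Hpt : a n <= 4 * INR r * (window_sum a 2 1 n / INR n) + window_sum d 2 1 n).
  { apply Rmult_le_compat_r with (r := ln (INR n)) in Hpt; lra. }
  (* Average the telescoping inequality over the N points n - r j of [n/2, n]. *)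
  set (N := (n / (2 * r))%nat).
  assert (HN1 : (1 <= N)%nat) by (apply Nat.div_le_lower_bound; lia).
  assert (HN2 : (2 * r * N <= n)%nat) by apply Nat.Div0.mul_div_le.
  assert (HN3 : (n < 2 * r * S N)%nat) by (apply Nat.mul_succ_div_gt; lia).
  assert (Hhalf : (n / 2 <= n - r * N)%nat).
  { pose proof (Nat.Div0.mul_div_le n 2).
    enough (n < S (n - r * N) * 2)%nat.
    { apply Nat.lt_succ_r. apply Nat.Div0.div_lt_upper_bound. lia. } nia. }
  assert (Havg : INR N * a n <= window_sum a 2 1 n + INR N * window_sum d 2 1 n).
  { apply Rle_trans with (sum_n_m (fun j => a (n - r * j)%nat + window_sum d 2 1 n) 1 N).
    - apply Rle_trans with (sum_n_m (fun _ : nat => a n) 1 N).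
      { rewrite sum_n_m_const. replace (S N - 1)%nat with N by lia. lra. }
      apply Rsum_le. intros j Hj.
      assert (HjN : (r * j <= r * N)%nat) by (apply Nat.mul_le_mono_l; lia).
      eapply Rle_trans; [apply (Htel n j); lia|]. apply Rplus_le_compat_l.
      eapply Rle_trans; [apply Rsum_progression_le; auto; lia|].
      apply Rsum_subset; auto; lia.
    - rewrite Rsum_plus, sum_n_m_const. replace (S N - 1)%nat with N by lia.
      apply Rplus_le_compat_r.
      eapply Rle_trans; [apply Rsum_progression_le; auto; lia|].
      apply Rsum_subset; auto; lia. }
  assert (HNpos : 0 < INR N) by (apply lt_0_INR; lia).
  assert (HnN : INR n <= 4 * INR r * INR N).
  { replace 4 with (INR 4) by (simpl; ring). rewrite <- !mult_INR. apply le_INR. nia. }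
  pose proof (HW0 a 2%nat 1%nat n Ha) as Hwa.
  assert (Hinv : / INR N <= 4 * INR r * / INR n).
  { apply Rmult_le_reg_r with (INR N * INR n); [now apply Rmult_lt_0_compat|].
    replace (/ INR N * (INR N * INR n)) with (INR n) by (field; lra).
    replace (4 * INR r * / INR n * (INR N * INR n)) with (4 * INR r * INR N) by (field; lra).
    exact HnN. }
  apply Rle_trans with (/ INR N * window_sum a 2 1 n + window_sum d 2 1 n).
  - apply Rmult_le_reg_l with (INR N); [exact HNpos|].
    rewrite Rmult_plus_distr_l, <- Rmult_assoc, Rinv_r, Rmult_1_l by lra. exact Havg.
  - apply Rplus_le_compat_r. unfold Rdiv.
    replace (4 * INR r * (window_sum a 2 1 n * / INR n))
      with (4 * INR r * / INR n * window_sum a 2 1 n) by ring.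
    now apply Rmult_le_compat_r.
Qed.

Theorem theorem2 (r : nat) (hr : (1 <= r)%nat) (c : Z -> C) (beta : nat -> R)
  (hbeta0 : beta 0%nat = 0)
  (hbeta : forall n : nat, (1 <= n)%nat -> 0 <= beta n)
  (hGM : GM beta r (fun n : nat => c (Z.of_nat n)))
  (hdom : exists gamma : R, 1 < gamma /\
    dominated
      (fun n : nat => sum_n_m beta (n / 2) n)
      (fun n : nat => sum_n_m (fun k : nat => Cmod (c (Z.of_nat k)))
         (int_part_nat (INR n / gamma)) (int_part_nat (gamma * INR n))))
  (hnorm : is_lim_seq
    (fun n : nat => L1norm (fun x : R => (fejer_mean c n x - partial_sum c n x)%C)) 0) :
  is_lim_seq (fun n : nat => Cmod (c (Z.of_nat n)) * ln (INR n)) 0.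
Proof.
  destruct hGM as [K hK]. destruct hdom as (gamma & hgamma & K2 & hK2 & hdom).
  apply logarithmic_decay with
    (a := fun n => Cmod (c (Z.of_nat n)))
    (d := fun n => Cmod (c (Z.of_nat n) - c (Z.of_nat (n + r)))%C)
    (e := fun n => L1norm (fun x : R => (fejer_mean c n x - partial_sum c n x)%C)) (r := r).
  - exact hr.
  - intros k. apply Cmod_ge_0.
  - intros k. apply Cmod_ge_0.
  - intros n. apply L1norm_fejer_diff_nonneg.
  - exact hnorm.
  - intros n hn. now apply coef_le_L1norm_fejer_diff.
  - intros n N hn hN. now apply harmonic_mult_coef_le.
  - intros n j hj.
    pose proof (r_step_variation (fun k => c (Z.of_nat k)) r n j hj) as H. cbv beta in H.
    replace (c (Z.of_nat n)) with
      (c (Z.of_nat (n - r * j)) + (c (Z.of_nat n) - c (Z.of_nat (n - r * j))))%C at 1 by ring.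
    eapply Rle_trans; [apply Cmod_triangle|]. now apply Rplus_le_compat_l.
  - apply variation_le_average with beta K K2 gamma; auto.
    + intros k. apply Cmod_ge_0.
    + intros k. apply Cmod_ge_0.
    + intros [|k]; [rewrite hbeta0; lra | apply hbeta; lia].
Qed.
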